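(* Let $\boldsymbol{w}$ be a fork-preserving mutation sequence. The sign-vector of $C^{\boldsymbol{w}}$ depends only on the signs of the entries of the initial exchange matrix $B$, and not on the number of arrows between vertices of the initial quiver. That is: if $B=[b_{ij}]$ and $B'=[b'_{ij}]$ are two forks on the vertex set $\{1,\dots,n\}$ with $\mathrm{sgn}(b_{ij})=\mathrm{sgn}(b'_{ij})$ for all $i,j$, and $\boldsymbol{w}$ is a mutation sequence that is fork-preserving from both $B$ and $B'$, then the sign-vector of the $C$-matrix of $B$ obtained from $\boldsymbol{w}$ equals the sign-vector of the $C$-matrix of $B'$ obtained from $\boldsymbol{w}$.
   Context: A quiver on the vertex set $\{1,\dots,n\}$ (no loops, no oriented 2-cycles) is identified with an $n\times n$ skew-symmetric integer matrix $B=[b_{ij}]$: if $b_{ij}>0$ there are $b_{ij}$ arrows from $i$ to $j$. Mutation: for an $n\times 2n$ integer matrix $M=[m_{ij}]$ and $k\in\{1,\dots,n\}$, the mutation of $M$ at $k$ is the matrix with entries $-m_{ij}$ if $i=k$ or $j=k$, and $m_{ij}+\mathrm{sgn}(m_{ik})\max(m_{ik}m_{kj},0)$ otherwise. A mutation sequence $\boldsymbol{w}=[i_1,\dots,i_\ell]$ (possibly empty) means mutating at $i_1$, then $i_2$, etc.; it is reduced if $i_j\ne i_{j+1}$ for all $j$. Starting from $[B\mid I]$, the result after $\boldsymbol{w}$ is written $[B^{\boldsymbol{w}}\mid C^{\boldsymbol{w}}]$; $C^{\boldsymbol{w}}$ is the $C$-matrix and its rows $c_1^{\boldsymbol{w}},\dots,c_n^{\boldsymbol{w}}$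 are the $c$-vectors. It is known that every $c$-vector is nonzero with all nonzero entries of the same sign. The sign-vector of $C^{\boldsymbol{w}}$ has $i$-th entry $1$ if all entries of $c_i^{\boldsymbol{w}}$ are $\ge 0$ and $-1$ if all are $\le 0$. A quiver is abundant if there are at least two arrows between every pair of distinct vertices. A fork is an abundant, non-acyclic quiver $F=[f_{ij}]$ with a vertex $r$ (the point of return, which is unique) such that, with $F^-(r)$ the set of vertices having arrows to $r$ and $F^+(r)$ the set of vertices receiving arrows from $r$: for all $i\in F^-(r)$, $j\in F^+(r)$ one has $f_{ji}>f_{ir}$ and $f_{ji}>f_{rj}$; and the full subquivers on $F^-(r)$ and on $F^+(r)$ are acyclic. A fork-preserving mutation sequence from a fork with point of return $r$ is a reduced mutation sequence whose first mutation (if any) is not at $r$. *)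

(* Defs.v *)
From HB Require Import structures.
From mathcomp Require Import all_boot all_order all_algebra.

Set Implicit Arguments.
Unset Strict Implicit.
Unset Printing Implicit Defensive.

Import Order.TTheory GRing.Theory Num.Theory.
Local Open Scope ring_scope.

(* Over int, skew-symmetry forces a zero diagonal (no loops), and encoding the
   arrows by signed entries leaves no room for oriented 2-cycles. *)
Definition is_quiver (n : nat) (B : 'M[int]_n) : Prop := B^T = - B.

Definition arrow (n : nat) (B : 'M[int]_n) : rel 'I_n :=
  fun i j => 0 < B i j.

Definition in_nbrs (n : nat) (B : 'M[int]_n) (r : 'I_n) : {set 'I_n} :=
  [set i | arrow B i r].

Definition out_nbrs (n : nat) (B : 'M[int]_n) (r : 'I_n) : {set 'I_n} :=
  [set j | arrow B r j].

(* The full subquiver on A has no oriented cycle; the library predicate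
   [cycle] holds of the empty sequence, which is why it is singled out. *)
Definition acyclic_on (n : nat) (B : 'M[int]_n) (A : {set 'I_n}) : Prop :=
  forall p : seq 'I_n, {subset p <= A} -> cycle (arrow B) p -> p = [::].

Definition acyclic (n : nat) (B : 'M[int]_n) : Prop :=
  acyclic_on B [set: 'I_n].

Definition abundant (n : nat) (B : 'M[int]_n) : Prop :=
  forall i j : 'I_n, i != j -> 2 <= `|B i j|.

Definition fork_with_return (n : nat) (B : 'M[int]_n) (r : 'I_n) : Prop :=
  [/\ [/\ is_quiver B, abundant B & ~ acyclic B],
      forall i j : 'I_n, i \in in_nbrs B r -> j \in out_nbrs B r ->
        B i r < B j i /\ B r j < B j i,
      acyclic_on B (in_nbrs B r)
    & acyclic_on B (out_nbrs B r)].

Definition is_fork (n : nat) (B : 'M[int]_n) : Prop :=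
  exists r : 'I_n, fork_with_return B r.

Definition reduced (n : nat) (w : seq 'I_n) : bool :=
  sorted (fun i j => i != j) w.

(* The point of return of a fork is unique, so the existential over r only
   names it. *)
Definition fork_preserving (n : nat) (B : 'M[int]_n) (w : seq 'I_n) : Prop :=
  exists r : 'I_n,
    [/\ fork_with_return B r, reduced w & ohead w != Some r].

(* The vertex k indexes row k, and column k of the left half. *)
Definition mutate (n : nat) (M : 'M[int]_(n, n + n)) (k : 'I_n) :
    'M[int]_(n, n + n) :=
  \matrix_(i < n, j < n + n)
    if (i == k) || (j == lshift n k) then - M i j
    else M i j +
         Num.sg (M i (lshift n k)) * Num.max (M i (lshift n k) * M k j) 0.

Definition mutate_seq (n : nat) (M : 'M[int]_(n, n + n)) (w : seq 'I_n) :
    'M[int]_(n, n + n) :=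
  foldl (@mutate n) M w.

Definition C_matrix (n : nat) (B : 'M[int]_n) (w : seq 'I_n) : 'M[int]_n :=
  rsubmx (mutate_seq (row_mx B 1%:M) w).

(* The value 0 is a default for rows with entries of both signs; by
   sign-coherence no c-vector takes it. The c-vectors are also nonzero, so the
   order of the two tests is immaterial. *)
Definition sign_vector (n : nat) (C : 'M[int]_n) : 'rV[int]_n :=
  \row_(i < n)
    if [forall j, 0 <= C i j] then 1
    else if [forall j, C i j <= 0] then -1
    else 0.

(* Main.v *)
Require Import Defs.
From HB Require Import structures.
From mathcomp Require Import all_boot all_order all_algebra.
From mathcomp Require Import zify.

Set Implicit Arguments.
Unset Strict Implicit.
Unset Printing Implicit Defensive.

Import Order.TTheory GRing.Theory Num.Theory.
Local Open Scope ring_scope.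

(* After a mutation at k, a fork has point of return k, and the arrows between
   the remaining vertices keep their signs except that i -> k -> j forces
   i -> j; so the signs of the exchange matrix evolve autonomously.  Call a pair
   of vertices discordant if its arrow goes from a vertex with negative c-vector
   to one with positive c-vector.  Along a fork-preserving sequence every
   discordant pair contains the current point of return r, whose c-vector is
   then dominated, in absolute value, by the other one.  As the next mutation is
   at k <> r and the multiplicities are at least 2, every row changed by it
   takes the sign of row k: the signs of the c-vectors evolve by a rule that
   only sees the signs of the exchange matrix.  This also proves
   sign-coherence along the sequence. *)

(** * Mutation of [[B | C]], block by block *)

Definition mutate_entry (b p q : int) : int := b + Num.sg p * Num.max (p * q) 0.

Definition mutate_exchange (n : nat) (B : 'M[int]_n) (k : 'I_n) : 'M[int]_n :=
  \matrix_(i, j) if (i == k) || (j == k) then - B i j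
                 else mutate_entry (B i j) (B i k) (B k j).

Definition mutate_coeff (n : nat) (B C : 'M[int]_n) (k : 'I_n) : 'M[int]_n :=
  \matrix_(i, j) if i == k then - C i j
                 else mutate_entry (C i j) (B i k) (C k j).

Lemma mutate_row_mx (n : nat) (B C : 'M[int]_n) (k : 'I_n) :
  mutate (row_mx B C) k = row_mx (mutate_exchange B k) (mutate_coeff B C k).
Proof.
apply/matrixP=> i j; rewrite mxE; case: (split_ordP j) => a ->.
  by rewrite !row_mxEl !mxE (inj_eq (@lshift_inj _ _)).
by rewrite !row_mxEr row_mxEl !mxE eq_rlshift orbF.
Qed.

Lemma mutate_entry_pos (b p q e : int) :
    e = 1 \/ e = -1 -> 0 < e * p -> 0 <= e * q ->
  mutate_entry b p q = b + e * (p * q).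
Proof.
rewrite /mutate_entry => -[] -> p_gt0 q_ge0.
  have p0 : 0 < p by lia.
  by rewrite gtr0_sg // max_l //; nia.
have p0 : p < 0 by lia.
by rewrite ltr0_sg // max_l //; nia.
Qed.

Lemma mutate_entry_id (b p q : int) : p * q <= 0 -> mutate_entry b p q = b.
Proof. by move=> pq; rewrite /mutate_entry max_r // mulr0 addr0. Qed.

(* What the argument uses of a fork: non-acyclicity is dropped, and acyclicity
   away from r only matters for oriented triangles. *)
Definition prefork (n : nat) (B : 'M[int]_n) (r : 'I_n) : Prop :=
  [/\ forall i j, B i j = - B j i,
      abundant B,
      forall i j, 0 < B i r -> 0 < B r j -> B i r < B j i /\ B r j < B j i
    & forall i j l, i != r -> j != r -> l != r ->
        0 < B i j -> 0 < B j l -> 0 < B l i -> False].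

(** By the fork inequality, arrows between the two sides of [r] all go from out-neighbours to
    in-neighbours. An oriented triangle avoiding [r] thus stays on one side, which is acyclic. *)
Lemma prefork_of_fork (n : nat) (B : 'M[int]_n) (r : 'I_n) :
  fork_with_return B r -> prefork B r.
Proof.
case=> [[quivB abB _] retB acyc_in acyc_out].
have skew i j : B i j = - B j i.
  by have /matrixP/(_ j i) := quivB; rewrite !mxE.
have ret i j : 0 < B i r -> 0 < B r j -> B i r < B j i /\ B r j < B j i.
  by move=> ir rj; apply: retB; rewrite inE.
split=> // i j l ni nj nl ij jl li.
have side a : a != r -> 0 < B a r \/ 0 < B r a.
  by move=> na; have := abB _ _ na; have := skew a r; lia.
have no_cross a b : 0 < B a b -> 0 < B a r -> 0 < B r b -> False.
  by move=> ab ar rb; have := ret _ _ ar rb; have := skew a b; lia.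
have triangle (A : {set 'I_n}) :
    i \in A -> j \in A -> l \in A -> acyclic_on B A -> False.
  move=> iA jA lA /(_ [:: i; j; l]) H; have// : [:: i; j; l] = [::].
  apply: H => [x|]; last by rewrite /= /arrow ij jl li.
  by rewrite !inE => /or3P[] /eqP->.
case: (side _ ni) (side _ nj) (side _ nl) => [ir|ri] [jr|rj] [lr|rl];
  try by [apply: (no_cross _ _ ij) | apply: (no_cross _ _ jl)
         | apply: (no_cross _ _ li)].
  by apply: triangle acyc_in; rewrite inE.
by apply: triangle acyc_out; rewrite inE.
Qed.

(** * Forks under mutation away from the point of return *)

Section PreforkMutation.
Variables (n : nat) (B : 'M[int]_n) (r k : 'I_n).
Hypothesis preB : prefork B r.

Let skew : forall i j, B i j = - B j i. Proof. by case: preB. Qed.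
Let ab : abundant B. Proof. by case: preB. Qed.
Let ret : forall i j, 0 < B i r -> 0 < B r j -> B i r < B j i /\ B r j < B j i.
Proof. by case: preB. Qed.
Let notri : forall i j l, i != r -> j != r -> l != r ->
  0 < B i j -> 0 < B j l -> 0 < B l i -> False.
Proof. by case: preB. Qed.

Let B1 := mutate_exchange B k.

Let neq_arrow i j : 0 < B i j -> i != j.
Proof.
by move=> ij; apply/eqP=> eij; move: ij (skew i j); rewrite eij; lia.
Qed.

Lemma mutate_exchange_l i : B1 k i = - B k i.
Proof. by rewrite mxE eqxx. Qed.

Lemma mutate_exchange_r i : B1 i k = - B i k.
Proof. by rewrite mxE eqxx orbT. Qed.

Lemma mutate_exchange_skew i j : B1 i j = - B1 j i.
Proof.
have [->|ik] := eqVneq i k.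
  by rewrite mutate_exchange_l mutate_exchange_r (skew k j).
have [->|jk] := eqVneq j k.
  by rewrite mutate_exchange_l mutate_exchange_r (skew i k) opprK.
rewrite !mxE (negbTE ik) (negbTE jk) /= /mutate_entry.
rewrite (skew i j) (skew k j) (skew k i) mulrN mulrN (mulrC (B j k)).
have [pq|pq] := leP 0 (- (B i k * B j k)); last by rewrite !mulr0; lia.
have [ik0|ik0|->] := ltgtP (B i k) 0; have [jk0|jk0|->] := ltgtP (B j k) 0;
  rewrite ?(ltr0_sg ik0) ?(gtr0_sg ik0) ?(ltr0_sg jk0) ?(gtr0_sg jk0) ?sgr0;
  nia.
Qed.

(** No path runs through [k] between two vertices on the same side of it; [e] selects the side. *)
Lemma mutate_exchange_same (e : int) i j :
    e = 1 \/ e = -1 -> 0 < e * B i k -> 0 < e * B j k ->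
  B1 i j = B i j.
Proof.
have skk := skew k k; move=> e1 ik jk.
have nik : i != k by apply: contraTneq ik => ->; rewrite -leNgt; lia.
have njk : j != k by apply: contraTneq jk => ->; rewrite -leNgt; lia.
rewrite mxE (negbTE nik) (negbTE njk) /= mutate_entry_id // (skew k j) mulrN.
by case: e1 ik jk => -> ik jk; nia.
Qed.

Hypothesis kr : k != r.

(** Only arrows from [j] to [i] could oppose the new ones. They close an oriented triangle, so [i]
    or [j] is [r]; their number is then below that of the side opposite [r], while the product
    [B i k * B k j] is at least twice the latter. *)
Lemma mutate_exchange_through i j : 0 < B i k -> 0 < B k j ->
  B i k < B1 i j /\ B k j < B1 i j.
Proof.
move=> ik kj.
have nik := neq_arrow ik; have nkj := neq_arrow kj.
have nij : i != j.
  by apply/eqP=> eij; move: ik kj (skew i k); rewrite eij; lia.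
have -> : B1 i j = B i j + B i k * B k j.
  rewrite mxE (negbTE nik) eq_sym (negbTE nkj) /=.
  by rewrite (@mutate_entry_pos _ _ _ 1) ?mul1r //; [left | lia].
have aik : 2 <= B i k by have := ab nik; lia.
have akj : 2 <= B k j by have := ab nkj; lia.
have sij := skew i j.
have [ij|ji] : 0 < B i j \/ 0 < B j i by have := ab nij; lia.
  by nia.
have [ei|ni] := eqVneq i r.
  by subst i; have [] := ret ji ik; nia.
have [ej|nj] := eqVneq j r.
  by subst j; have [] := ret kj ji; nia.
by case: (notri ni kr nj ik kj ji).
Qed.

Let side a : a != k -> 0 < B a k \/ 0 < B k a.
Proof. by move=> na; have := ab na; have := skew a k; lia. Qed.

(** The fork inequality at [r] makes [k] point to [b] if [e = 1], and [a] point to [k] if [e = -1],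
    against the assumed sides. *)
Let no_path_at_r e a b : e = 1 \/ e = -1 ->
  0 < e * B r k -> 0 < e * B a k -> 0 < e * B b k ->
  0 < B r a -> 0 < B b r -> False.
Proof.
move=> e1 rk ak bk ra br; have srk := skew r k; have sbk := skew b k.
have sak := skew a k; case: e1 => ee; subst e.
  have rk0 : 0 < B r k by lia.
  by have := ret br rk0; lia.
have kr0 : 0 < B k r by lia.
by have := ret kr0 ra; lia.
Qed.

Let no_triangle e i j l : e = 1 \/ e = -1 ->
  0 < e * B i k -> 0 < e * B j k -> 0 < e * B l k ->
  0 < B i j -> 0 < B j l -> 0 < B l i -> False.
Proof.
move=> e1 ik jk lk ij jl li.
have [ei|ni] := eqVneq i r.
  by subst i; case: (no_path_at_r e1 ik jk lk ij li).
have [ej|nj] := eqVneq j r.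
  by subst j; case: (no_path_at_r e1 jk lk ik jl ij).
have [el|nl] := eqVneq l r.
  by subst l; case: (no_path_at_r e1 lk ik jk li jl).
exact: notri ni nj nl ij jl li.
Qed.

Lemma prefork_mutate : prefork B1 k.
Proof.
split.
- exact: mutate_exchange_skew.
- have big i j : 0 < B i k -> 0 < B k j -> 2 <= `|B1 i j|.
    move=> ik kj; have [] := mutate_exchange_through ik kj.
    by have := ab (neq_arrow ik); lia.
  move=> i j nij.
  have [ei|ni] := eqVneq i k.
    by subst i; rewrite mutate_exchange_l normrN ab.
  have [ej|nj] := eqVneq j k.
    by subst j; rewrite mutate_exchange_r normrN ab.
  have [ik|ki] := side ni; have [jk|kj] := side nj.
  - by rewrite (@mutate_exchange_same 1) ?ab ?mul1r //; left.
  - exact: big.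
  - by rewrite mutate_exchange_skew normrN big.
  rewrite (@mutate_exchange_same (-1)) ?ab ?(skew _ k) ?mulrNN ?mul1r //.
  by right.
- move=> i j; rewrite mutate_exchange_l mutate_exchange_r => ki jk.
  have jk' : 0 < B j k by have := skew j k; lia.
  have ki' : 0 < B k i by have := skew i k; lia.
  have := mutate_exchange_through jk' ki'.
  by have := skew i k; have := skew j k; lia.
- move=> i j l ni nj nl ij jl li.
  (* Arrows between the two sides of [k] now run from its old in-neighbours to its old
     out-neighbours, so a triangle stays on one side, where nothing changed. *)
  have back a b : 0 < B1 a b -> 0 < B b k -> 0 < B k a -> False.
    move=> ab' bk ka; have := mutate_exchange_through bk ka.
    by have := mutate_exchange_skew a b; lia.
  have same e : e = 1 \/ e = -1 ->
      0 < e * B i k -> 0 < e * B j k -> 0 < e * B l k -> False.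
    move=> e1 ik jk lk; apply: (no_triangle e1 ik jk lk).
    - by rewrite -(mutate_exchange_same e1 ik jk).
    - by rewrite -(mutate_exchange_same e1 jk lk).
    - by rewrite -(mutate_exchange_same e1 lk ik).
  have pos a : 0 < B a k -> 0 < 1 * B a k by rewrite mul1r.
  have neg a : 0 < B k a -> 0 < -1 * B a k by rewrite (skew a k) mulrNN mul1r.
  case: (side ni) (side nj) (side nl) => [ik|ki] [jk|kj] [lk|kl];
    try by [apply: back ij _ _ | apply: back jl _ _ | apply: back li _ _].
    by apply: (same 1); [left | apply: pos..].
  by apply: (same (-1)); [right | apply: neg..].
Qed.

End PreforkMutation.

(** An entry is negated, kept, or joins the two sides of [k]; in the last case the composed arrows
    win in both forks, whatever the multiplicities. *)
Lemma mutate_exchange_sg (n : nat) (B B' : 'M[int]_n) (r r' k : 'I_n) :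
    prefork B r -> prefork B' r' -> k != r -> k != r' ->
    (forall i j, Num.sg (B i j) = Num.sg (B' i j)) ->
  forall i j, Num.sg (mutate_exchange B k i j)
            = Num.sg (mutate_exchange B' k i j).
Proof.
move=> pB pB' kr kr' sBB i j.
have pos a b : (0 < B a b) = (0 < B' a b) by rewrite -!sgr_cp0 sBB.
have [ei|ni] := eqVneq i k.
  by subst i; rewrite !mutate_exchange_l !sgrN sBB.
have [ej|nj] := eqVneq j k.
  by subst j; rewrite !mutate_exchange_r !sgrN sBB.
have through a b : 0 < B a k -> 0 < B k b ->
    Num.sg (mutate_exchange B k a b) = Num.sg (mutate_exchange B' k a b).
  move=> ak kb; have [ak1 _] := mutate_exchange_through pB kr ak kb.
  have ak' : 0 < B' a k by rewrite -pos.
  have kb' : 0 < B' k b by rewrite -pos.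
  have [ak1' _] := mutate_exchange_through pB' kr' ak' kb'.
  by rewrite !gtr0_sg //; lia.
case: (pB) => skew ab _ _.
have side a : a != k -> 0 < B a k \/ 0 < B k a.
  by move=> na; have := ab _ _ na; have := skew a k; lia.
have same e : e = 1 \/ e = -1 -> 0 < e * B i k -> 0 < e * B j k ->
    Num.sg (mutate_exchange B k i j) = Num.sg (mutate_exchange B' k i j).
  move=> e1 ik jk.
  rewrite (mutate_exchange_same pB e1) // (mutate_exchange_same pB' e1) //.
    by rewrite -sgr_cp0 sgrM -sBB -sgrM sgr_cp0.
  by rewrite -sgr_cp0 sgrM -sBB -sgrM sgr_cp0.
have [ik|ki] := side _ ni; have [jk|kj] := side _ nj.
- by apply: (same 1); [left | lia..].
- exact: through.
- rewrite (mutate_exchange_skew k pB) (mutate_exchange_skew k pB') !sgrN.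
  by congr (- _); apply: through.
- apply: (same (-1)); first by right.
    by have := skew i k; lia.
  by have := skew j k; lia.
Qed.

(** * Signs of the c-vectors under mutation *)

Definition mutate_sign (n : nat) (B : 'M[int]_n) (e : 'I_n -> int) (k : 'I_n) :
    'I_n -> int :=
  fun i => if i == k then - e k else if 0 < e k * B i k then e k else e i.

(* [discordant B e i j] says that, for e valued in {1, -1}, the arrow between i
   and j goes from the negative to the positive vertex; it is symmetric. *)
Definition discordant (n : nat) (B : 'M[int]_n) (e : 'I_n -> int) : rel 'I_n :=
  fun i j => (e i == - e j) && (0 < e j * B i j).

(* The third clause holds initially because e is constant, and later because the
   rows changed by the mutation at r all took the same sign; it prevents
   discordant pairs containing r from surviving the next mutation. *)
Definition coherent (n : nat) (B C : 'M[int]_n) (r : 'I_n) (e : 'I_n -> int) :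
    Prop :=
  [/\ forall i, e i = 1 \/ e i = -1,
      forall i, (forall a, 0 <= e i * C i a) /\ (exists a, C i a != 0),
      forall i j, 0 < e r * B i r -> 0 < e r * B j r -> e i = e j
    & forall i j, discordant B e i j ->
        i = r /\ (forall a, e i * C i a <= e j * C j a)
     \/ j = r /\ (forall a, e j * C j a <= e i * C i a)].

Lemma coherent_identity (n : nat) (B : 'M[int]_n) (r : 'I_n) :
  coherent B 1%:M r (fun=> 1).
Proof.
split=> // i; first by left.
split=> [a|]; first by rewrite mul1r mxE; case: eqP.
by exists i; rewrite mxE eqxx.
Qed.

Lemma coherent_mutate (n : nat) (B C : 'M[int]_n) (r k : 'I_n)
    (e : 'I_n -> int) :
    prefork B r -> k != r -> coherent B C r e ->
  coherent (mutate_exchange B k) (mutate_coeff B C k) k (mutate_sign B e k).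
Proof.
move=> pB kr [e1 eC er dis]; case: (pB) => skew ab ret notri.
pose B1 := mutate_exchange B k; pose C1 := mutate_coeff B C k.
pose e' := mutate_sign B e k.
have e'k : e' k = - e k by rewrite /e' /mutate_sign eqxx.
have e'in i : 0 < e k * B i k -> e' i = e k.
  rewrite /e' /mutate_sign => ik; rewrite ik ifN //.
  by apply/eqP=> ei; move: ik (skew i k); rewrite ei; case: (e1 k) => ->; lia.
have e'out i : i != k -> e k * B i k <= 0 -> e' i = e i.
  by rewrite /e' /mutate_sign => /negbTE-> ik; rewrite ltNge ik.
have C1k a : C1 k a = - C k a by rewrite mxE eqxx.
have C1out i : i != k -> e k * B i k <= 0 -> forall a, C1 i a = C i a.
  move=> /negbTE ik ik0 a; rewrite mxE ik mutate_entry_id //.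
  have [/(_ a) + _] := eC k; move: ik0; case: (e1 k) => ->; nia.
(* Row [i] gains at least two copies of row [k]. If their signs differ, the pair is discordant, so
   [i = r] and row [i] cancels at most one copy. *)
have C1in i : 0 < e k * B i k -> forall a, e k * C k a <= e k * C1 i a.
  move=> ik a; have nik : i != k.
    by apply/eqP=> ei; move: ik (skew i k); rewrite ei; case: (e1 k) => ->; lia.
  have [/(_ a) ka _] := eC k; have [/(_ a) ia _] := eC i.
  rewrite mxE (negbTE nik) (mutate_entry_pos _ (e1 k)) //.
  have aik := ab _ _ nik.
  have low : - (e k * C k a) <= e k * C i a.
    have [ee|ee] := eqVneq (e i) (- e k).
      have [|[ir]|[//]] := dis i k; first by rewrite /discordant ee eqxx.
        by move=> /(_ a); rewrite ee; lia.
      by move=> ekr; rewrite ekr eqxx in kr.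
    have ek : e i = e k by move: ee; case: (e1 i) (e1 k) => -> [] ->.
    by rewrite ek in ia; lia.
  have p2 : 2 <= e k * B i k by move: ik; case: (e1 k) => ->; lia.
  have -> : e k * (C i a + e k * (B i k * C k a))
          = e k * C i a + (e k * B i k) * (e k * C k a) by lia.
  by nia.
have e'1 i : e' i = 1 \/ e' i = -1.
  rewrite /e' /mutate_sign; case: ifP => _; last by case: ifP.
  by case: (e1 k) => ->; [right | left].
have disC i j : discordant B1 e' i j -> discordant B1 e' j i.
  rewrite /discordant => /andP[/eqP eij].
  rewrite (mutate_exchange_skew k pB i j).
  by rewrite eij opprK eqxx mulrN mulNr.
change (coherent B1 C1 k e'); split=> //.
- move=> i; have [->|ik] := eqVneq i k.
    have [kp [b kb]] := eC k; split=> [a|]; rewrite ?C1k ?e'k.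
      by rewrite mulrNN kp.
    by exists b; rewrite C1k oppr_eq0.
  have [ik0|ik0] := ltP 0 (e k * B i k).
    have [kp [b kb]] := eC k; rewrite (e'in _ ik0); split=> [a|].
      exact: le_trans (kp a) (C1in _ ik0 a).
    exists b; have := C1in _ ik0 b; have := kp b.
    by move: kb; case: (e1 k) => ->; lia.
  have [ip [b ib]] := eC i; rewrite (e'out _ ik ik0); split=> [a|].
    by rewrite C1out.
  by exists b; rewrite C1out.
(* Both [e k] and [B i k] change sign, so the rows in question are those just changed. *)
- have sgn i : 0 < e' k * B1 i k -> e' i = e k.
    by rewrite e'k mutate_exchange_r mulrNN; apply: e'in.
  by move=> i j /sgn-> /sgn->.
have at_k j : discordant B1 e' k j ->
    forall a, e' k * C1 k a <= e' j * C1 j a.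
  move=> /andP[/eqP + +] a.
  rewrite e'k mutate_exchange_l C1k mulrNN => /oppr_inj ekj.
  rewrite -ekj => dj; apply: C1in; move: dj; rewrite (skew k j); lia.
(* The new arrow between [i] and [j] goes from the vertex on the positive side to the negative one,
   opposite to a discordant arrow. *)
have not_through i j : 0 < e k * B i k -> e k * B j k <= 0 -> j != k ->
    ~~ discordant B1 e' i j.
  move=> ik jk njk; apply/negP=> /andP[/eqP]; rewrite (e'in i) // => eij.
  have ajk := ab _ _ njk.
  have -> : e' j = - e k by lia.
  have : 0 < e k * B1 i j.
    case: (e1 k) ik jk => ->; rewrite ?mulN1r ?mul1r => ik jk.
      have kj : 0 < B k j by have := skew k j; lia.
      by have := mutate_exchange_through pB kr ik kj; rewrite -/B1; lia.
    have ki : 0 < B k i by have := skew k i; lia.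
    have jk' : 0 < B j k by lia.
    have := mutate_exchange_through pB kr jk' ki; rewrite -/B1.
    by rewrite (mutate_exchange_skew k pB i j) -/B1; lia.
  by lia.
have no_r j : e k * B r k <= 0 -> e k * B j k <= 0 -> j != k ->
    ~~ discordant B e r j.
  move=> rk jk njk; apply/negP=> /andP[/eqP erj rj].
  have ajk := ab _ _ njk; have ark := ab _ _ kr; have skk := skew k r.
  have srj := skew r j; have sjk := skew j k.
  (* Since [e r] and [e j] are opposite, [e k] is one of them. The third clause of [coherent]
     excludes [e r]; the fork inequality on the path through [k], [r], [j] excludes [e j]. *)
  have [ee|ee] : e k = e r \/ e k = e j.
    by have := e1 k; have := e1 r; lia.
    have kj : e k = e j.
      by apply: er; rewrite -ee; case: (e1 k) => ek; rewrite ek in ee rk *; lia.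
    by have := e1 k; lia.
  case: (e1 k) => ek; rewrite -ee ek in rk jk rj.
    have kr0 : 0 < B k r by lia.
    have rj0 : 0 < B r j by lia.
    by have := ret _ _ kr0 rj0; lia.
  have rk0 : 0 < B r k by lia.
  have jr0 : 0 < B j r by lia.
  by have := ret _ _ jr0 rk0; lia.
move=> i j dij.
have [ei|ni] := eqVneq i k.
  by left; split=> //; subst i; apply: at_k.
have [ej|nj] := eqVneq j k.
  by right; split=> //; subst j; apply: at_k; apply: disC.
exfalso.
(* Two changed rows share a sign. Two unchanged ones lie on the same side of [k], so their arrow is
   kept and the pair was already discordant, hence contains [r]. *)
have [ik|ik] := ltP 0 (e k * B i k); have [jk|jk] := ltP 0 (e k * B j k).
- by case/andP: dij => /eqP; rewrite !e'in //; case: (e1 k) => ->.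
- by have := not_through _ _ ik jk nj; rewrite dij.
- by have := not_through _ _ jk ik ni; rewrite disC.
have ek1 : - e k = 1 \/ - e k = -1 by case: (e1 k) => ->; [right | left].
have ik' : 0 < - e k * B i k by have := ab _ _ ni; case: (e1 k) ik => ->; lia.
have jk' : 0 < - e k * B j k by have := ab _ _ nj; case: (e1 k) jk => ->; lia.
have {}dij : discordant B e i j.
  by move: dij; rewrite /discordant !e'out // /B1 (mutate_exchange_same pB ek1).
have [//|[ir _]|[jr _]] := dis i j.
  by subst i; have := no_r j ik jk nj; rewrite dij.
subst j; have := no_r i jk ik ni; case/negP.
move: dij; rewrite /discordant => /andP[/eqP eij].
by rewrite (skew i r) eij opprK eqxx /=; lia.
Qed.

Lemma coherent_sign_vector (n : nat) (B C : 'M[int]_n) (r : 'I_n)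
    (e : 'I_n -> int) :
  coherent B C r e -> sign_vector C = \row_i e i.
Proof.
case=> e1 eC _ _; apply/rowP=> i; rewrite !mxE.
have [ip [b ib]] := eC i.
case: (e1 i) => ei; rewrite ei in ip *.
  by rewrite ifT //; apply/forallP=> a; have := ip a; lia.
(* A nonzero entry makes a negative row fail the first test. *)
rewrite ifN; last by apply/forallPn; exists b; have := ip b; lia.
by rewrite ifT //; apply/forallP=> a; have := ip a; lia.
Qed.

(** Arbitrary [C], [C'] and points of return let the induction start at any stage; after each step
    both forks return at the vertex just mutated. *)
Lemma sign_vector_mutate_seq (n : nat) (w : seq 'I_n)
    (B B' C C' : 'M[int]_n) (r r' : 'I_n) (e e' : 'I_n -> int) :
    prefork B r -> prefork B' r' -> e =1 e' ->
    (forall i j, Num.sg (B i j) = Num.sg (B' i j)) ->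
    coherent B C r e -> coherent B' C' r' e' ->
    reduced w -> ohead w != Some r -> ohead w != Some r' ->
  sign_vector (rsubmx (mutate_seq (row_mx B C) w))
  = sign_vector (rsubmx (mutate_seq (row_mx B' C') w)).
Proof.
elim: w => [|k w IHw] in B B' C C' r r' e e' *.
  move=> _ _ ee _ cB cB' _ _ _; rewrite /= !row_mxKr.
  rewrite (coherent_sign_vector cB) (coherent_sign_vector cB').
  by apply/rowP=> i; rewrite !mxE.
move=> pB pB' ee sBB cB cB' red /= kr kr'.
have {}kr : k != r by apply: contraNneq kr => ->.
have {}kr' : k != r' by apply: contraNneq kr' => ->.
(* Reducedness keeps the next mutation away from the new point of return [k]. *)
have nk : ohead w != Some k.
  case: w red {IHw} => //= j w /andP[kj _].
  by apply: contraNneq kj => -[->].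
have cB1 := coherent_mutate pB kr cB.
have cB1' := coherent_mutate pB' kr' cB'.
rewrite !mutate_row_mx.
apply: (IHw _ _ _ _ k k (mutate_sign B e k)
  (mutate_sign B' e' k)) => //.
- exact: prefork_mutate pB kr.
- exact: prefork_mutate pB' kr'.
- move=> i; rewrite /mutate_sign !ee.
  by rewrite -sgr_cp0 sgrM sBB -sgrM sgr_cp0.
- exact: mutate_exchange_sg pB pB' kr kr' sBB.
- exact: path_sorted red.
Qed.

Theorem theorem1p8 (n : nat) (B B' : 'M[int]_n) (w : seq 'I_n)
    (fork_B : is_fork B) (fork_B' : is_fork B')
    (sgn_BB' : forall i j : 'I_n, Num.sg (B i j) = Num.sg (B' i j))
    (w_B : fork_preserving B w) (w_B' : fork_preserving B' w) :
  sign_vector (C_matrix B w) = sign_vector (C_matrix B' w).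
Proof.
case: w_B w_B' => r [fB red wr] [r' [fB' _ wr']].
exact: (sign_vector_mutate_seq (prefork_of_fork fB) (prefork_of_fork fB')
  (fun=> erefl) sgn_BB' (coherent_identity B r) (coherent_identity B' r')
  red wr wr').
Qed.
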